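(* Suppose all groups are interior, i.e. $1\le y_j\le n_j-1$ for every $j=1,\dots,k$. Let $u>0$ and let $r$ have hyper-prior density $f(r)\propto 1/r^{u+1}$ on $(0,\infty)$, and independently let $\boldsymbol\beta$ have a proper hyper-prior probability density function $g(\boldsymbol\beta)$ on $\mathbf R^m$. Then the joint posterior density function of the hyper-parameters, $\pi_{\mathrm{hyp.post}}(r,\boldsymbol\beta\mid\boldsymbol y)\propto f(r)\,g(\boldsymbol\beta)\,L(r,\boldsymbol\beta)$, is proper if and only if $k\ge u+1$.
   Context: Beta-Binomial-Logit model. There are $k\ge 1$ groups; group $j$ has an integer number of trials $n_j\ge 1$, an observed number of successes $y_j\in\{0,1,\dots,n_j\}$, and a fixed covariate vector $\boldsymbol x_j\in\mathbf R^m$, with $k\ge m\ge 1$. Put $\boldsymbol y=(y_1,\dots,y_k)^\top$. The hyper-parameters are $r\in(0,\infty)$ and $\boldsymbol\beta\in\mathbf R^m$. Write $$p^E_j=p^E_j(\boldsymbol\beta)=\frac{\exp(\boldsymbol x_j^\top\boldsymbol\beta)}{1+\exp(\boldsymbol x_j^\top\boldsymbol\beta)},\qquad q^E_j=1-p^E_j .$$ The likelihood function (a product of Beta-Binomial probability mass functions) is $$L(r,\boldsymbol\beta)=\prod_{j=1}^k\binom{n_j}{y_j}\frac{B(y_j+rp^E_j,\;n_j-y_j+rq^E_j)}{B(rp^E_j,\;rq^E_j)},$$ where $B(a,b)=\int_0^1 v^{a-1}(1-v)^{b-1}\,dv$ for $a,b>0$ is the beta function. Given hyper-prior densities $f(r)$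 and $g(\boldsymbol\beta)$ (possibly improper), the posterior $\pi_{\mathrm{hyp.post}}(r,\boldsymbol\beta\mid\boldsymbol y)\propto f(r)g(\boldsymbol\beta)L(r,\boldsymbol\beta)$ is called proper if $\int_{\mathbf R^m}\int_0^\infty f(r)g(\boldsymbol\beta)L(r,\boldsymbol\beta)\,dr\,d\boldsymbol\beta<\infty$ and improper if this integral is infinite.
   Formalization: For non-integer u the condition k ≥ u+1 is not necessary (k=1, n=2, y=1, u=1/2 gives a proper posterior); the theorem proves proper iff k > u for every real u > 0, and proper iff k ≥ u+1 when u is an integer. *)

(* Defs.v *)
From HB Require Import structures.
From mathcomp Require Import all_boot all_order all_algebra.
From mathcomp Require Import all_classical all_reals all_analysis.
Set Implicit Arguments.
Unset Strict Implicit.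
Unset Printing Implicit Defensive.
Import Order.TTheory GRing.Theory Num.Theory.
Local Open Scope classical_set_scope.
Local Open Scope ring_scope.

Section PowerMeasure.
Context d (T : measurableType d) (R : realType).
Local Open Scope ereal_scope.

Definition cons_pair n (p : T * n.-tuple T) : n.+1.-tuple T :=
  [tuple of p.1 :: p.2].

Lemma measurable_cons_pair n : measurable_fun setT (@cons_pair n).
Proof. exact: measurable_cons. Qed.

Section Step.
Context (nu : {sigma_finite_measure set T -> \bar R}).
Context (n : nat) (mu : {sigma_finite_measure set (n.-tuple T) -> \bar R}).

Definition power_step : set (n.+1.-tuple T) -> \bar R :=
  pushforward (nu \x mu) (@cons_pair n).

Let power_step0 : power_step set0 = 0.
Proof. by rewrite /power_step /pushforward preimage_set0 measure0. Qed.

Let power_step_ge0 A : 0 <= power_step A.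
Proof. by rewrite /power_step /pushforward; exact: measure_ge0. Qed.

Let power_step_sigma_additive : semi_sigma_additive power_step.
Proof.
move=> F mF tF mUF; rewrite /power_step /pushforward preimage_bigcup.
have mpre A : measurable A -> measurable (@cons_pair n @^-1` A).
  by move=> mA; rewrite -[X in measurable X]setTI; exact: measurable_cons_pair.
apply: measure_semi_sigma_additive.
- by move=> i; exact: mpre.
- apply/trivIsetP => /= i j _ _ ij; rewrite -preimage_setI.
  by move/trivIsetP : tF => /(_ _ _ _ _ ij) ->//; rewrite preimage_set0.
- by rewrite -preimage_bigcup; exact: mpre.
Qed.

HB.instance Definition _ := isMeasure.Build _ _ _ power_step
  power_step0 power_step_ge0 power_step_sigma_additive.

Let power_step_sigma_finite : sigma_finite setT power_step.
Proof.
have [H [HT mH]] : exists H : nat -> set (T * n.-tuple T),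
    setT = \bigcup_i H i /\
    forall i, measurable (H i) /\ (nu \x mu) (H i) < +oo.
  have /sigma_finiteP[F [TF ndF Foo]] := sigma_finiteT nu.
  have /sigma_finiteP[G [TG ndG Goo]] := sigma_finiteT mu.
  exists (fun i => F i `*` G i); split.
    rewrite -setXTT TF TG predeqE => -[x y]; split; last first.
      by move=> [i _ []/= ? ?]; split; exists i.
    move=> [/= [i _ Fix] [j _ Gjy]]; exists (maxn i j) => //; split.
    - by move: x Fix; exact/subsetPset/ndF/leq_maxl.
    - by move: y Gjy; exact/subsetPset/ndG/leq_maxr.
  move=> i; have [? ?] := Foo i; have [? ?] := Goo i.
  split; first exact: measurableX.
  by rewrite product_measure1E// lte_mul_pinfty// ge0_fin_numE.
pose psi (t : n.+1.-tuple T) : T * n.-tuple T :=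
  (tnth t ord0, [tuple of behead t]).
have mpsi : measurable_fun setT psi.
  apply: measurable_fun_pair; first exact: measurable_tnth.
  exact: measurable_behead.
have psiK p : psi (@cons_pair n p) = p.
  by case: p => a t; rewrite /psi; congr pair; apply/val_inj.
exists (fun i => psi @^-1` H i); first by rewrite -preimage_bigcup -HT.
move=> i; have [mHi Hi] := mH i; split.
  by rewrite -[X in measurable X]setTI; exact: mpsi.
rewrite /power_step /pushforward.
suff -> : @cons_pair n @^-1` (psi @^-1` H i) = H i by exact: Hi.
by apply/seteqP; split => p; rewrite /preimage /= psiK.
Qed.

HB.instance Definition _ := Measure_isSigmaFinite.Build _ _ _ power_step
  power_step_sigma_finite.

End Step.

(** The n-fold product of [nu].  The recursion carries sigma-finiteness, which
    the binary product measure needs. *)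
Fixpoint power_measure (nu : {sigma_finite_measure set T -> \bar R}) (n : nat) :
    {sigma_finite_measure set (n.-tuple T) -> \bar R} :=
  match n with
  | 0 => \d_([tuple] : 0.-tuple T)
  | n'.+1 => power_step nu (power_measure nu n')
  end.

Lemma power_measure_box (nu : {sigma_finite_measure set T -> \bar R}) (n : nat)
    (A : 'I_n -> set T) : (forall i, measurable (A i)) ->
  power_measure nu n [set t | forall i, A i (tnth t i)] = \prod_(i < n) nu (A i).
Proof.
elim: n A => [|n IH] A mA.
  by rewrite big_ord0 /= diracE mem_set // => -[].
rewrite big_ord_recl /= /power_step /pushforward.
have -> : @cons_pair n @^-1` [set t | forall i, A i (tnth t i)] =
    A ord0 `*` [set t | forall i, A (lift ord0 i) (tnth t i)].
  apply/seteqP; split => -[a t] /=.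
    move=> H; split; first by have := H ord0.
    by move=> i; have := H (lift ord0 i); rewrite tnthS.
  move=> [Ha Ht] i; case: (unliftP ord0 i) => [j ->|->] //.
  by rewrite tnthS; exact: Ht.
have mB : measurable [set t : n.-tuple T | forall i, A (lift ord0 i) (tnth t i)].
  have -> : [set t : n.-tuple T | forall i, A (lift ord0 i) (tnth t i)] =
      \bigcap_(i in [set: 'I_n]) ((@tnth n T ^~ i) @^-1` A (lift ord0 i)).
    by apply/seteqP; split => t /= H i; [move=> _|]; exact: H.
  apply: fin_bigcap_measurable => [|i _]; first exact: finite_finset.
  by rewrite -[X in measurable X]setTI; exact: measurable_tnth.
rewrite product_measure1E //.
by congr (_ * _); exact: (IH (fun i => A (lift ord0 i))).
Qed.

End PowerMeasure.

(** Points of R^m are m-tuples, with the product (i.e. Borel) sigma-algebra. *)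
Definition lebesgue_tuple (R : realType) (m : nat) :=
  power_measure (@lebesgue_measure R) m.

Section BetaBinomialLogit.
Context (R : realType).

(** The Beta function at real arguments ([beta_fun] of the library takes
    natural numbers). *)
Definition Beta (a b : R) : R :=
  \int[@lebesgue_measure R]_(v in `]0, 1[) (v `^ (a - 1) * (1 - v) `^ (b - 1)).

Context (k m : nat).
Implicit Types (x : 'I_k -> m.-tuple R) (beta : m.-tuple R) (j : 'I_k).

Definition linpred x beta j : R := \sum_(i < m) tnth (x j) i * tnth beta i.

Definition pE x beta j : R := expR (linpred x beta j) / (1 + expR (linpred x beta j)).

Definition qE x beta j : R := 1 - pE x beta j.

Definition likelihood (n y : 'I_k -> nat) x (r : R) beta : R :=
  \prod_(j < k)
    ('C(n j, y j)%:R *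
     (Beta ((y j)%:R + r * pE x beta j) ((n j)%:R - (y j)%:R + r * qE x beta j)
      / Beta (r * pE x beta j) (r * qE x beta j))).

End BetaBinomialLogit.

Section Posterior.
Context (R : realType) (m : nat).

Definition is_pdf (g : m.-tuple (measurableTypeR R) -> R) : Prop :=
  [/\ measurable_fun setT g, (forall b, 0 <= g b) &
      (\int[lebesgue_tuple R m]_b (g b)%:E = 1)%E].

(** With [f r] proportional to
    [1 / r `^ (u + 1)], the integrand behaves like [r `^ (k - u - 1)] near [0]
    when all groups are interior, so the sharp threshold is [u < k]; this reads
    [u + 1 <= k] only for integer [u] (take [u = 1/2], [k = 1] otherwise). *)
Definition posterior_proper (f : R -> R) (g : m.-tuple (measurableTypeR R) -> R)
    (L : R -> m.-tuple R -> R) : Prop :=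
  (\int[lebesgue_tuple R m]_b
     \int[@lebesgue_measure R]_(r in `]0%R, +oo[) (f r * g b * L r b)%:E < +oo)%E.

End Posterior.

(* Main.v *)
Require Import Defs.
From mathcomp Require Import all_boot all_order all_algebra.
From mathcomp Require Import all_classical all_reals all_analysis.
From mathcomp Require Import ring lra measurable_realfun.
Import Order.TTheory GRing.Theory Num.Theory.
Import numFieldNormedType.Exports.
Local Open Scope classical_set_scope.
Local Open Scope ring_scope.

(** Only two regimes of [r] matter.  Near [0], [Beta (r p) (r q)] is of exact
    order [1 / r] while the numerator [Beta (y + r p) (n - y + r q)] of an
    interior group stays between positive constants, so each factor of the
    likelihood is of exact order [r]; away from [0] each factor is at most [1].
    The upper bound is uniform in [beta]; the constant of the lower bound
    depends on [beta], which is harmless because the inner integral is then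
    [+oo] wherever the prior density is positive.  Hence everything is decided
    by [r `^ (k - u - 1)] near [0].

    The integral of a nonnegative function is a supremum over simple functions,
    hence monotone without measurability, so the measurability of the
    likelihood in [r] and [beta] never has to be established. *)

(** * Monotonicity of nonnegative integrals, and estimates from antiderivatives *)

Section Integral.
Context (R : realType).
Implicit Types (f F : R -> R) (D : set R).
Notation mu := (@lebesgue_measure R).

Lemma ge0_le_integral_nomeas d (T : measurableType d)
    (nu : {measure set T -> \bar R}) (D : set T) (f1 f2 : T -> \bar R) :
  (forall x, D x -> 0 <= f1 x)%E -> (forall x, D x -> f1 x <= f2 x)%E ->
  (\int[nu]_(x in D) f1 x <= \int[nu]_(x in D) f2 x)%E.
Proof.
move=> f10 f12.
have f20 x : D x -> (0 <= f2 x)%E.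
  by move=> Dx; apply: le_trans (f12 _ Dx); exact: f10.
rewrite (ge0_integralE _ f10) (ge0_integralE _ f20).
apply: ereal_sup_le => _ [h hf1 <-] /=; exists h => // x.
apply: le_trans (hf1 x) _; rewrite !patchE; case: ifPn => // xD.
by apply: f12; rewrite inE in xD.
Qed.

Lemma ge0_subset_integral_nomeas d (T : measurableType d)
    (nu : {measure set T -> \bar R}) (A B : set T) (f : T -> \bar R) :
  (forall x, B x -> 0 <= f x)%E -> A `<=` B ->
  (\int[nu]_(x in A) f x <= \int[nu]_(x in B) f x)%E.
Proof.
move=> f0 AB; rewrite (integral_mkcond A) (integral_mkcond B).
apply: ge0_le_integral_nomeas => x _; rewrite !patchE.
  by case: ifPn => // xA; apply/f0/AB; rewrite inE in xA.
case: ifPn => [xA|_]; last by case: ifPn => // xB; apply: f0; rewrite inE in xB.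
by rewrite mem_set//; apply: AB; rewrite inE in xA.
Qed.

Lemma continuous_on_itv_measurable f (a b : R) :
  (forall x, a <= x <= b -> {for x, continuous f}) ->
  measurable_fun `[a, b] f.
Proof.
move=> cf; apply/measurable_EFinP.
apply: (@measurable_int _ _ R mu `[a, b] (EFin \o f)).
apply: continuous_compact_integrable; first exact: segment_compact.
by apply: continuous_in_subspaceT => x; rewrite inE/= in_itv/=; exact: cf.
Qed.

Lemma FTC2_derivable f F (a b : R) : a < b ->
  (forall x, a <= x <= b -> {for x, continuous f}) ->
  (forall x, a <= x <= b -> is_derive x 1 F (f x)) ->
  (\int[mu]_(x in `[a, b]) (f x)%:E = (F b - F a)%:E)%E.
Proof.
move=> ab cf dF.
have dFx x : a <= x <= b -> derivable F x 1.
  by move=> xab; have [] := dF _ xab.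
have cF x : a <= x <= b -> {for x, continuous F}.
  by move=> xab; apply: differentiable_continuous; apply/derivable1_diffP; exact: dFx.
rewrite (@continuous_FTC2 _ f F a b) ?EFinB//.
- apply: continuous_in_subspaceT => x; rewrite inE/= in_itv/=; exact: cf.
- split.
  + by move=> x; rewrite in_itv/= => /andP[ax xb]; apply: dFx; rewrite !ltW.
  + by apply: cvg_at_right_filter; apply: cF; rewrite lexx ltW.
  + by apply: cvg_at_left_filter; apply: cF; rewrite lexx ltW.
- move=> x; rewrite in_itv/= => /andP[ax xb].
  by rewrite derive1E; have [] := dF x; rewrite ?ltW.
Qed.

(** The segments [[a n, b n]] exhaust [D], so the integral is the limit of the increments
    [F (b n) - F (a n)]. A bound on all increments of [F] inside [D] therefore suffices, and no
    limit of [F] at an endpoint of [D] has to be computed. *)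
Lemma integral_le_of_antiderivative f F D (a b : nat -> R) (M : R) :
  (forall n, a n < b n) ->
  nonincreasing_seq a -> nondecreasing_seq b -> D = \bigcup_n `[a n, b n]%classic ->
  (forall x, D x -> 0 <= f x) ->
  (forall x, D x -> {for x, continuous f}) ->
  (forall x, D x -> is_derive x 1 F (f x)) ->
  (forall x y, D x -> D y -> F y - F x <= M) ->
  (\int[mu]_(x in D) (f x)%:E <= M%:E)%E.
Proof.
move=> ab na nb DE f0 cf dF FM.
have inD n x : a n <= x <= b n -> D x.
  by move=> xn; rewrite DE; exists n => //=; rewrite in_itv.
pose I n : set (measurableTypeR R) := `[a n, b n]%classic.
have ndI : nondecreasing_seq I.
  move=> p q pq; rewrite subsetEset => x; rewrite /I /= !in_itv/= => /andP[ax xb].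
  by rewrite (le_trans (na _ _ pq))//= (le_trans xb)//; exact: nb.
have mI i : @measurable _ (measurableTypeR R) (I i) by exact: measurable_itv.
have mf i : @measurable_fun _ _ (measurableTypeR R) _ (I i) (fun x => (f x)%:E).
  apply/measurable_EFinP; rewrite /I; apply: continuous_on_itv_measurable.
  by move=> x /inD; exact: cf.
have I0 i x : I i x -> (0 <= (f x)%:E)%E.
  by rewrite /I /= in_itv/= lee_fin => /inD; exact: f0.
have /cvg_lim := @ge0_nondecreasing_set_cvg_integral _ _ _ I _ mu ndI mI mf I0.
rewrite -[X in integral _ X]DE => <- //.
apply: lime_le.
  apply/ereal_nondecreasing_is_cvgn.
  exact: (@ge0_nondecreasing_set_nondecreasing_integral _ _ _ I _ mu ndI mI mf I0).
apply: nearW => n; rewrite (@FTC2_derivable f F _ _ (ab n)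
  (fun x xn => cf _ (inD n x xn)) (fun x xn => dF _ (inD n x xn))).
by rewrite lee_fin; apply: FM; apply: (inD n); rewrite lexx ltW.
Qed.

Lemma integral_ge_of_antiderivative f F D (a b : R) :
  a < b -> `[a, b] `<=` D ->
  (forall x, D x -> 0 <= f x) ->
  (forall x, a <= x <= b -> {for x, continuous f}) ->
  (forall x, a <= x <= b -> is_derive x 1 F (f x)) ->
  ((F b - F a)%:E <= \int[mu]_(x in D) (f x)%:E)%E.
Proof.
move=> ab abD f0 cf dF; rewrite -(@FTC2_derivable f F _ _ ab cf dF).
by apply: ge0_subset_integral_nomeas => // x Dx; rewrite lee_fin; exact: f0.
Qed.

End Integral.

(** * Real powers: an integrable majorant on the half-line and a divergent minorant *)

Section Power.
Context (R : realType).
Notation mu := (@lebesgue_measure R).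
Implicit Types s v r u c : R.

Lemma is_derive_continuous (f : R -> R) v df : is_derive v 1 f df -> {for v, continuous f}.
Proof.
by move=> [dfv _]; apply: differentiable_continuous; apply/derivable1_diffP.
Qed.

Lemma is_derive_powR_div s v : 0 < s -> 0 < v ->
  is_derive v 1 (fun t => t `^ s / s) (v `^ (s - 1)).
Proof.
move=> s0 v0; have dp := @is_derive1_powR _ s _ v0.
have -> : (fun t : R => t `^ s / s) = s^-1 \*: (fun t => t `^ s).
  by apply/funext => t /=; rewrite mulrC.
by apply: is_derive_eq; rewrite /GRing.scale/= mulrA mulVf ?mul1r// gt_eqF.
Qed.

Lemma is_derive_onem v : is_derive v 1 (fun t : R => 1 - t) (- 1).
Proof. by apply: is_derive_eq; rewrite add0r mul1r. Qed.

Lemma is_derive_powR_onem_div s v : 0 < s -> v < 1 ->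
  is_derive v 1 (fun t => - ((1 - t) `^ s / s)) ((1 - v) `^ (s - 1)).
Proof.
move=> s0 v1; have v0 : 0 < 1 - v by rewrite subr_gt0.
have dp := is_derive_powR_div _ _ s0 v0.
have dc := is_derive_onem v.
have dd := @is_derive1_comp _ (fun t => t `^ s / s) (fun t => 1 - t) v _ _ dp dc.
by apply: is_derive_eq; rewrite mulrN1 opprK.
Qed.

Lemma continuous_powR s v : 0 < v -> {for v, continuous (fun t : R => t `^ s)}.
Proof. by move=> v0; apply: is_derive_continuous; exact: is_derive1_powR. Qed.

Lemma continuous_powR_onem s v : v < 1 -> {for v, continuous (fun t : R => (1 - t) `^ s)}.
Proof.
move=> v1; have v0 : 0 < 1 - v by rewrite subr_gt0.
apply: is_derive_continuous.
exact: (@is_derive1_comp _ (fun t => t `^ s) (fun t => 1 - t) v _ _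
  (@is_derive1_powR _ s _ v0) (is_derive_onem v)).
Qed.

(** The shift by 3 makes the first segment [[1/3, 2/3]], so that none is degenerate. A point enters
    once [1 / (n + 3)] is below its distance [w] to the nearer endpoint. *)
Lemma itv01_bigcup : `]0, 1[%classic =
  \bigcup_n `[n.+3%:R^-1, 1 - n.+3%:R^-1]%classic :> set R.
Proof.
apply/seteqP; split => [v|v [n _]] /=; rewrite !in_itv/=; last first.
  move=> /andP[nv vn]; have n0 : 0 < n.+3%:R^-1 :> R by rewrite invr_gt0.
  by rewrite (lt_le_trans n0 nv) (le_lt_trans vn)// gtrBl.
move=> /andP[v0 v1]; pose w := Num.min v (1 - v).
have w0 : 0 < w by rewrite lt_min v0 subr_gt0.
have [n nw] : exists n, n.+3%:R^-1 <= w.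
  exists (Num.truncn w^-1); rewrite invf_ple ?posrE//.
  apply: le_trans (ltW (truncnS_gt _)) _.
  by rewrite ler_nat ltnW.
exists n => //=; rewrite in_itv/=; move: nw; rewrite /w le_min => /andP[nv n1v].
by rewrite nv/= lerBrDr -lerBrDl.
Qed.

Lemma itv0y_bigcup : `]0, +oo[%classic =
  \bigcup_n `[n.+2%:R^-1, n.+2%:R]%classic :> set R.
Proof.
apply/seteqP; split => [v|v [n _]] /=; rewrite !in_itv/= ?andbT; last first.
  by move=> /andP[nv vn]; rewrite (lt_le_trans _ nv)// invr_gt0.
move=> v0; exists (Num.truncn (Num.max v v^-1)) => //=; rewrite in_itv/=.
have := truncnS_gt (Num.max v v^-1); rewrite gt_max => /andP[/ltW v1 /ltW v2].
set N := (Num.truncn _).+1 in v1 v2 *.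
have NS : N%:R <= N.+1%:R :> R by rewrite ler_nat.
by rewrite (le_trans v1)// andbT invf_ple ?posrE// (le_trans v2).
Qed.

(* The integrand is the derivative of [- c / (1 + r `^ s)]; it behaves like
   [r `^ (s - 1)] at [0] and like [r `^ (- s - 1)] at infinity. *)
Lemma integral_powR_bump_le c s : 0 <= c -> 0 < s ->
  (\int[mu]_(r in `]0%R, +oo[)
    (c * (s * r `^ (s - 1) / (1 + r `^ s) ^+ 2))%:E <= c%:E)%E.
Proof.
move=> c0 s0.
have p1 (r : R) : 0 < 1 + r `^ s by rewrite ltr_pwDl ?powR_ge0.
apply: (@integral_le_of_antiderivative R _ (fun r => - (c * (1 + r `^ s)^-1))
  _ (fun n => n.+2%:R^-1) (fun n => n.+2%:R)).
- by move=> n; rewrite (@lt_trans _ _ 1)// ?ltr1n// invf_lt1// ltr1n.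
- by move=> p q pq; rewrite lef_pV2 ?posrE// ler_nat.
- by move=> p q pq; rewrite ler_nat.
- exact: itv0y_bigcup.
- move=> r _; rewrite mulr_ge0//; apply: divr_ge0; first by rewrite mulr_ge0 ?powR_ge0// ltW.
  by rewrite exprn_ge0// ltW.
- move=> r /=; rewrite in_itv/= andbT => r0.
  have cp t : {for r, continuous (fun v => v `^ t)} by exact: continuous_powR.
  apply: continuousM; first exact: cvg_cst.
  apply: continuousM.
    by apply: continuousM; [exact: cvg_cst|exact: cp].
  apply: (@continuousV _ _ (fun x => (1 + x `^ s) ^+ 2)).
    by rewrite expf_neq0// gt_eqF.
  apply: (@continuous_comp _ _ _ (fun x => 1 + x `^ s) (fun x => x ^+ 2)).
    by apply: continuousD; [exact: cvg_cst|exact: cp].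
  exact: exprn_continuous.
- move=> r /=; rewrite in_itv/= andbT => r0.
  have dp := @is_derive1_powR _ s _ r0.
  have dD : is_derive r 1 (fun t => 1 + t `^ s) (s * r `^ (s - 1)).
    by apply: is_derive_eq; rewrite add0r mul1r.
  have dV := @is_deriveV _ (fun t => 1 + t `^ s) r _ 1 (lt0r_neq0 (p1 r)) dD.
  have -> : (fun r : R => - (c * (1 + r `^ s)^-1)) =
    (- c) \*: (fun r : R => (1 + r `^ s)^-1) 
    by apply/funext => t; rewrite /= /GRing.scale/= mulNr.
  by apply: is_derive_eq; rewrite /GRing.scale/=; field; rewrite gt_eqF.
- move=> x y _ _.
  have x1 : (1 + x `^ s)^-1 <= 1 by rewrite invf_le1// lerDl powR_ge0.
  have y1 : 0 < (1 + y `^ s)^-1 by rewrite invr_gt0.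
  rewrite opprK addrC -mulrBr ler_piMr//; lra.
Qed.

(** The left side is [r ^ (k - u - 1)] below 1 and [r ^ (- u - 1)] above. Taking for [s] the smaller
    of the two margins [k - u] and [u] lets a single bump dominate both regimes; the factor 4
    absorbs the denominator [(1 + r ^ s) ^ 2]. *)
Lemma powR_min_le_bump u (k : nat) r : 0 < u -> u < k%:R -> 0 < r ->
  forall s, s = Num.min (k%:R - u) u ->
  1 / r `^ (u + 1) * Num.min 1 r ^+ k <=
  4 / s * (s * r `^ (s - 1) / (1 + r `^ s) ^+ 2).
Proof.
move=> u0 uk r0 s sE.
have s0 : 0 < s by rewrite sE lt_min subr_gt0 uk u0.
have su : s <= u by rewrite sE ge_min lexx orbT.
have sk : s <= k%:R - u by rewrite sE ge_min lexx.
have rs0 : 0 < r `^ s by exact: powR_gt0.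
have p1 : 0 < 1 + r `^ s by rewrite ltr_pwDl ?powR_ge0.
have -> : 4 / s * (s * r `^ (s - 1) / (1 + r `^ s) ^+ 2) =
    4 * r `^ (s - 1) / (1 + r `^ s) ^+ 2.
  by field; rewrite !gt_eqF.
rewrite ler_pdivlMr ?exprn_gt0//.
have rN t : 1 / r `^ t = r `^ (- t) by rewrite powRN div1r.
have rD t t' : r `^ (t + t') = r `^ t * r `^ t'.
  by rewrite powRD// (gt_eqF r0)/= implybT.
rewrite rN; case: (leP 1 r) => r1.
  rewrite expr1n mulr1.
  have r's1 : 1 <= r `^ s by rewrite -(powRr0 r) ler_powR// ltW.
  (* The first factor dominates [r ^ (- (u + 1))] because [s <= u]; the second, with the 4, is
     [(2 r ^ s) ^ 2], which dominates the denominator because [r ^ s >= 1]. *)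
  have -> : r `^ (s - 1) = r `^ (- (s + 1)) * (r `^ s) ^+ 2.
    by rewrite expr2 -!rD; congr (_ `^ _); ring.
  rewrite [4 * _]mulrCA; apply: ler_pM; rewrite ?powR_ge0 ?exprn_ge0// ?(ltW p1)//.
    by rewrite ler_powR// lerN2 lerD2r.
  have -> : 4 * (r `^ s) ^+ 2 = (r `^ s + r `^ s) ^+ 2 by ring.
  by rewrite lerXn2r ?nnegrE ?(ltW p1)// ?lerD2r// addr_ge0// ltW.
rewrite -[r ^+ k]powR_mulrn ?(ltW r0)// -rD.
(* Below 1 the denominator is at most 4, and [s <= k - u] compares the powers. *)
have r's1 : r `^ s <= 1 by rewrite -(powRr0 r) ger_powR ?r0 ?ltW.
rewrite [4 * _]mulrC; apply: ler_pM; rewrite ?powR_ge0 ?exprn_ge0// ?(ltW p1)//.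
  by rewrite ger_powR ?r0 ?(ltW r1)//; lra.
have -> : 4 = (1 + 1) ^+ 2 :> R by ring.
by rewrite lerXn2r ?nnegrE ?(ltW p1)// lerD2l.
Qed.

Lemma integral_inv_pinfty c : 0 < c -> forall (f : R -> R),
  (forall r, 0 < r -> 0 <= f r) -> (forall r, 0 < r <= 1 -> c / r <= f r) ->
  (\int[mu]_(r in `]0%R, +oo[) (f r)%:E = +oo)%E.
Proof.
move=> c0 f f0 cf; apply/eqyP => M M0.
(* Chosen so that the integral of [c / r] over [[e, 1]], namely [- c * ln e], is exactly [M]. *)
pose e := expR (- (M / c)).
have eM : e < 1 by rewrite /e expR_lt1 oppr_lt0 divr_gt0.
have e0 : 0 < e by exact: expR_gt0.
have inI r : e <= r <= 1 -> 0 < r.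
  by move=> /andP[er _]; exact: lt_le_trans er.
have le1 : (M%:E <= \int[mu]_(r in `[e, 1%R]) (c / r)%:E)%E.
  have -> : M = c * ln 1 - c * ln (e).
    by rewrite /e ln1 expRK mulr0 sub0r mulrN opprK mulrC divfK ?gt_eqF.
  apply: (@integral_ge_of_antiderivative R (fun r => c / r) (fun r => c * ln r)) => //.
  - move=> r /=; rewrite in_itv/= => /inI r0.
    by rewrite divr_ge0 ?ltW.
  - move=> r /inI r0; apply: continuousM; first exact: cvg_cst.
    by apply: continuousV; rewrite ?gt_eqF//; exact: cvg_id.
  - move=> r /inI r0; have dl := @is_derive1_ln _ _ r0.
    exact: (@is_deriveZ _ _ _ _ c).
apply: (le_trans le1).
have le2 := @ge0_subset_integral_nomeas R _ (measurableTypeR R) mu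
  `[e, 1]%classic `]0, +oo[%classic (fun r => (f r)%:E).
apply: le_trans (le2 _ _).
- apply: ge0_le_integral_nomeas => r /=; rewrite in_itv/= => rI.
    by rewrite lee_fin divr_ge0 ?(ltW c0)// ltW// inI.
  by rewrite lee_fin cf// (inI _ rI); case/andP: rI.
- by move=> r /=; rewrite in_itv/= andbT lee_fin; exact: f0.
- by move=> r /=; rewrite !in_itv/= andbT; exact: inI.
Qed.

End Power.

(** * Two-sided estimates of the beta function *)

Section BetaBounds.
Context (R : realType).
Notation mu := (@lebesgue_measure R).
Implicit Types a b v : R.

(** The beta integral with values in the extended reals, where comparison of integrands applies
    before finiteness is known. *)
Let eBeta a b : \bar R :=
  (\int[mu]_(v in `]0%R, 1%R[) (v `^ (a - 1) * (1 - v) `^ (b - 1))%:E)%E.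

Lemma ger_powR_itv01 v a b : 0 < v < 1 -> a <= b -> v `^ b <= v `^ a.
Proof. by move=> /andP[v0 v1] ab; rewrite ger_powR// v0 ltW. Qed.

(** Since [b - 1 > - 1] and the base lies in [[1/2, 1)], the power is at most [1 / (1 - v) <= 2]. *)
Lemma powR_onem_le2 v b : 0 < v <= 1 / 2 -> 0 < b -> (1 - v) `^ (b - 1) <= 2.
Proof.
move=> /andP[v0 v2] b0.
have w0 : 0 < 1 - v < 1 by apply/andP; split; lra.
have -> : 2 = 2 `^ 1 :> R by rewrite powRr1.
apply: (@le_trans _ _ ((1 - v) `^ (- 1))).
  by apply: ger_powR_itv01 => //; lra.
rewrite powR_inv1 ?powRr1; [|lra..].
rewrite invf_ple ?posrE; lra.
Qed.

(** On each half of the interval the factor whose singularity lies at the far endpoint is at most 2,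
    and the other factor has an explicit antiderivative. *)
Lemma eBeta_le a b : 0 < a -> 0 < b -> (eBeta a b <= (2 / a + 2 / b)%:E)%E.
Proof.
move=> a0 b0.
pose f v := 2 * v `^ (a - 1) + 2 * (1 - v) `^ (b - 1).
pose F v := 2 * (v `^ a / a) + 2 * - ((1 - v) `^ b / b).
apply: (@le_trans _ _ (\int[mu]_(v in `]0%R, 1%R[) (f v)%:E)%E).
  apply: ge0_le_integral_nomeas => v /=; rewrite in_itv/= => v01.
    by rewrite lee_fin mulr_ge0 ?powR_ge0.
  rewrite lee_fin /f; have [v0 v1] := andP v01.
  have p1 := powR_ge0 v (a - 1); have p2 := powR_ge0 (1 - v) (b - 1).
  have [v2|v2] := leP v (1 / 2).
    have h : (1 - v) `^ (b - 1) <= 2 by apply: powR_onem_le2; rewrite ?v0.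
    have : v `^ (a - 1) * (1 - v) `^ (b - 1) <= v `^ (a - 1) * 2 by rewrite ler_wpM2l.
    by lra.
  (* The right half follows from the left one by the reflection of [v] to [1 - v]. *)
  have h : (1 - (1 - v)) `^ (a - 1) <= 2 by apply: powR_onem_le2 => //; lra.
  have e : 1 - (1 - v) = v by ring.
  rewrite e in h.
  have : v `^ (a - 1) * (1 - v) `^ (b - 1) <= 2 * (1 - v) `^ (b - 1) by rewrite ler_wpM2r.
  by lra.
have pos01 v : `]0, 1[%classic v -> 0 < v < 1 by rewrite /= in_itv.
have n3 n : n.+3%:R^-1 <= 3^-1 :> R by rewrite lef_pV2 ?posrE// ler_nat.
apply: (@integral_le_of_antiderivative R f F _
  (fun n => n.+3%:R^-1) (fun n => 1 - n.+3%:R^-1)).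
- by move=> n; move: (n.+3%:R^-1) (n3 n) => e ?; lra.
- by move=> p q pq; rewrite lef_pV2 ?posrE// ler_nat.
- by move=> p q pq; rewrite lerD2l lerN2 lef_pV2 ?posrE// ler_nat.
- exact: itv01_bigcup.
- by move=> v _; rewrite addr_ge0// mulr_ge0// powR_ge0.
- move=> v /pos01 /andP[v0 v1]; apply: continuousD; apply: continuousM.
  + exact: cvg_cst.
  + exact: continuous_powR.
  + exact: cvg_cst.
  + exact: continuous_powR_onem.
- move=> v /pos01 /andP[v0 v1].
  have d1 := @is_derive_powR_div R _ _ a0 v0; have d2 := @is_derive_powR_onem_div R _ _ b0 v1.
  exact: (@is_deriveD _ _ _ _ _ _ _ _ _ (@is_deriveZ _ _ _ _ 2 _ _ _ d1)
    (@is_deriveZ _ _ _ _ 2 _ _ _ d2)).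
(* Both terms of [F] vary within ranges of lengths [2 / a] and [2 / b], which bounds its
   increments. *)
- have bnd v t : 0 < v < 1 -> 0 < t -> 0 <= v `^ t / t <= 1 / t.
    move=> v01 t0; rewrite divr_ge0 ?powR_ge0 ?(ltW t0)//= ler_pM2r ?invr_gt0//.
    by rewrite -(powRr0 v) ger_powR_itv01// ltW.
  move=> x y /pos01 x01 /pos01 y01; rewrite /F.
  have on v : 0 < v < 1 -> 0 < 1 - v < 1 by move=> ?; lra.
  have := bnd _ _ x01 a0; have := bnd _ _ y01 a0.
  have := bnd _ _ (on _ x01) b0; have := bnd _ _ (on _ y01) b0.
  have -> : 2 / a = 2 * (1 / a) by rewrite mul1r.
  have -> : 2 / b = 2 * (1 / b) by rewrite mul1r.
  move: (1 / a) (1 / b) (y `^ a / a) (x `^ a / a) ((1 - y) `^ b / b) ((1 - x) `^ b / b).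
  by move=> *; lra.
Qed.

(* [Beta] is a [Rintegral], which is [0] by convention on an infinite integral. *)
Lemma eBeta_fin a b : 0 < a -> 0 < b -> eBeta a b = (Beta a b)%:E.
Proof.
move=> a0 b0; rewrite /Beta /Rintegral fineK// ge0_fin_numE.
  by rewrite (le_lt_trans (eBeta_le _ _ a0 b0))// ltry.
by apply: integral_ge0 => v _; rewrite lee_fin mulr_ge0 ?powR_ge0.
Qed.

Lemma Beta_le a b : 0 < a -> 0 < b -> Beta a b <= 2 / a + 2 / b.
Proof. by move=> a0 b0; rewrite -lee_fin -eBeta_fin//; exact: eBeta_le. Qed.

Lemma Beta_antitone a b a' b' : 0 < a -> 0 < b -> a <= a' -> b <= b' ->
  Beta a' b' <= Beta a b.
Proof.
move=> a0 b0 aa bb; have a'0 := lt_le_trans a0 aa; have b'0 := lt_le_trans b0 bb.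
rewrite -lee_fin -!eBeta_fin//; apply: ge0_le_integral_nomeas => v /=.
  by rewrite lee_fin mulr_ge0 ?powR_ge0.
rewrite in_itv/= => v01; rewrite lee_fin ler_pM ?powR_ge0//.
  by apply: ger_powR_itv01 => //; rewrite lerD2r.
by apply: ger_powR_itv01; rewrite ?lerD2r//; lra.
Qed.

Lemma Beta_gt0 a b : 0 < a -> 0 < b -> 0 < Beta a b.
Proof.
(* [A] exceeds both exponents [a - 1] and [b - 1], so on [[1/4, 3/4]], where [v] and [1 - v] are at
   least 1/4, each factor is at least [(1/4) ^ A]. *)
move=> a0 b0; pose A := a + b.
pose c := 4^-1 `^ A * 4^-1 `^ A : R.
have c0 : 0 < c by rewrite mulr_gt0// powR_gt0// invr_gt0.
have A0 : 0 < A by rewrite addr_gt0.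
apply: (@lt_le_trans _ _ (c * (3 / 4) - c * (1 / 4))); first by lra.
rewrite -lee_fin -eBeta_fin//.
have le1 : ((c * (3 / 4) - c * (1 / 4))%:E <=
    \int[mu]_(v in `[(1 / 4)%R, (3 / 4)%R]) (cst c v)%:E)%E.
  apply: (@integral_ge_of_antiderivative R (cst c) (fun v => c * v)) => //.
  - by lra.
  - by move=> v _; exact: ltW.
  - by move=> v _; exact: cvg_cst.
  - by move=> v _; apply: is_derive_eq; rewrite /GRing.scale/= mulr1.
apply: (le_trans le1).
have sub v : 1 / 4 <= v <= 3 / 4 -> 0 < v < 1 by move=> ?; lra.
have mono v t : 4^-1 <= v < 1 -> t <= A -> 4^-1 `^ A <= v `^ t.
  move=> /andP[v4 v1] tA; apply: (@le_trans _ _ (v `^ A)).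
    by apply: ge0_ler_powR; rewrite ?nnegrE//; lra.
  by apply: ger_powR_itv01 => //; lra.
apply: le_trans (@ge0_subset_integral_nomeas R _ (measurableTypeR R) mu
  `[1 / 4, 3 / 4]%classic `]0, 1[%classic
  (fun v => (v `^ (a - 1) * (1 - v) `^ (b - 1))%:E) _ _).
- apply: ge0_le_integral_nomeas => v /=; first by rewrite lee_fin ltW.
  rewrite in_itv/= => v4; rewrite lee_fin ler_pM ?powR_ge0//.
    by apply: mono; rewrite /A; lra.
  by apply: mono; rewrite /A; lra.
- by move=> v _; rewrite lee_fin mulr_ge0 ?powR_ge0.
- by move=> v /=; rewrite !in_itv/=; exact: sub.
Qed.

(** As [b <= 1], the factor in [1 - v] is at least 1, leaving the integral of [v ^ (a - 1)] over
    [[c, 1/2]]. The endpoint [c] solves [c ^ a = 1/4], while [(1/2) ^ a >= 1/2] because [a <= 1];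
    the difference divided by [a] gives the bound. *)
Lemma Beta_ge a b : 0 < a -> a <= 1 -> 0 < b -> b <= 1 -> 1 / (4 * a) <= Beta a b.
Proof.
move=> a0 a1 b0 b1; pose c := 4^-1 `^ a^-1 : R.
have cE : c `^ a = 4^-1 by rewrite -powRrM mulVf ?gt_eqF// powRr1.
have c0 : 0 < c by rewrite powR_gt0// invr_gt0.
have c2 : c < 2^-1.
  apply: (@le_lt_trans _ _ 4^-1); last by lra.
  rewrite -[leRHS]powRr1 ?invr_ge0//; apply: ger_powR_itv01; first by lra.
  by rewrite invf_ge1.
have h2 : 2^-1 <= 2^-1 `^ a :> R.
  by rewrite -[leLHS]powRr1 ?invr_ge0//; apply: ger_powR_itv01 => //; lra.
apply: (@le_trans _ _ (2^-1 `^ a / a - c `^ a / a)).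
  rewrite -mulrBl invfM mulrA ler_pM2r ?invr_gt0// cE; lra.
have sub v : c <= v <= 2^-1 -> 0 < v < 1 by move=> ?; lra.
rewrite -lee_fin -eBeta_fin//.
apply: (@le_trans _ _ (\int[mu]_(v in `]0%R, 1%R[) (v `^ (a - 1))%:E)%E).
  apply: (@integral_ge_of_antiderivative R (fun v => v `^ (a - 1)) (fun v => v `^ a / a)) => //.
  - by move=> v _; exact: powR_ge0.
  - by move=> v /sub /andP[v0 _]; exact: continuous_powR.
  - by move=> v /sub /andP[v0 _]; exact: is_derive_powR_div.
apply: ge0_le_integral_nomeas => v /=; rewrite ?lee_fin ?powR_ge0//.
rewrite in_itv/= => v01; rewrite ler_peMr ?powR_ge0//.
by rewrite -[leLHS](powRr0 (1 - v)) ger_powR_itv01//; lra.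
Qed.

End BetaBounds.

(** * A single interior group: its beta ratio as a function of [r] *)

Section BetaRatio.
Context (R : realType) (n y : nat) (p : R).
Hypothesis hy : (1 <= y <= n - 1)%N.
Hypothesis p01 : 0 < p < 1.

(** A factor of the likelihood without its binomial coefficient. It sees [beta] only through [p], so
    a bound uniform in [p] is uniform in [beta]. *)
Definition beta_ratio (r : R) : R :=
  Beta (y%:R + r * p) (n%:R - y%:R + r * (1 - p)) / Beta (r * p) (r * (1 - p)).

Let y1 : 1 <= y%:R :> R.
Proof. by rewrite ler1n; case/andP: hy. Qed.

Let ny1 : 1 <= n%:R - y%:R :> R.
Proof.
case/andP: hy => h1 h2.
(* The subtraction in [hy] is truncated: for [n = 0] it reads [y <= 0], which [1 <= y] excludes. *)
have yn : (y.+1 <= n)%N.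
  by move: h1 h2; case: (n) => [|n'] h1; rewrite subn1//= leqn0 => /eqP y0; rewrite y0 in h1.
by rewrite lerBrDr addrC natr1 ler_nat.
Qed.

Let yn : y%:R + 1 <= n%:R :> R.
Proof. by have := ny1; lra. Qed.

Lemma beta_ratio_ge0 r : 0 < r -> 0 <= beta_ratio r.
Proof.
move=> r0; have [p0 p1] := andP p01.
have rp : 0 < r * p by rewrite mulr_gt0.
have rq : 0 < r * (1 - p) by rewrite mulr_gt0// subr_gt0.
rewrite divr_ge0// ltW// Beta_gt0//.
  by rewrite addr_gt0// (lt_le_trans ltr01).
by rewrite addr_gt0// (lt_le_trans ltr01).
Qed.

(** For [r >= 1] antitonicity alone bounds the ratio by 1. For [r < 1] the numerator is at most
    [Beta 1 1 <= 4] and the denominator at least [1 / (4 r p)]; the resulting [16 r p] is at most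
    [16 r], whatever [p] is. *)
Lemma beta_ratio_le r : 0 < r -> beta_ratio r <= 16 * Num.min 1 r.
Proof.
move=> r0; have [p0 p1] := andP p01.
have rp : 0 < r * p by rewrite mulr_gt0.
have rq : 0 < r * (1 - p) by rewrite mulr_gt0// subr_gt0.
have B0 := Beta_gt0 _ _ _ rp rq.
rewrite /beta_ratio ler_pdivrMr//; have [r1|r1] := leP 1 r.
  have : Beta (y%:R + r * p) (n%:R - y%:R + r * (1 - p)) <= Beta (r * p) (r * (1 - p)).
    by apply: Beta_antitone => //; rewrite lerDr (le_trans ler01).
  by have := ltW B0; lra.
apply: (@le_trans _ _ (Beta 1 1)).
  by apply: Beta_antitone => //; rewrite -[leLHS]addr0 lerD// ltW.
apply: (@le_trans _ _ (2 / 1 + 2 / 1)); first exact: Beta_le.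
apply: (@le_trans _ _ (16 * r * (1 / (4 * (r * p))))).
  have -> : 16 * r * (1 / (4 * (r * p))) = 4 / p by field; rewrite !gt_eqF.
  rewrite divr1 ler_pdivlMr//; lra.
rewrite ler_wpM2l ?mulr_ge0 ?(ltW r0)//; apply: Beta_ge => //.
  by rewrite mulr_ile1 ?ltW.
by rewrite mulr_ile1 ?(ltW r0) ?(ltW r1)//; lra.
Qed.

(** For [r <= 1] both arguments of the numerator are at most [n + 1], and the denominator is at most
    [(2 / p + 2 / (1 - p)) / r]. This [d] degenerates as [p] tends to 0 or 1. *)
Lemma beta_ratio_ge : exists2 d : R, 0 < d &
  forall r, 0 < r <= 1 -> d * r <= beta_ratio r.
Proof.
have [p0 p1] := andP p01; have q0 : 0 < 1 - p by rewrite subr_gt0.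
have S0 : 0 < 2 / p + 2 / (1 - p) by rewrite addr_gt0// divr_gt0.
have n1 : 0 < n%:R + 1 :> R by rewrite ltr_wpDl.
exists (Beta (n%:R + 1) (n%:R + 1) / (2 / p + 2 / (1 - p))).
  by rewrite divr_gt0// Beta_gt0.
move=> r /andP[r0 r1].
have rp : 0 < r * p by rewrite mulr_gt0.
have rq : 0 < r * (1 - p) by rewrite mulr_gt0.
have rp1 : r * p <= 1 by rewrite mulr_ile1// ltW.
have rq1 : r * (1 - p) <= 1 by rewrite mulr_ile1 ?(ltW r0)//; lra.
have B0 := Beta_gt0 _ _ _ rp rq.
rewrite /beta_ratio ler_pdivlMr//.
apply: (@le_trans _ _ (Beta (n%:R + 1) (n%:R + 1))); last first.
  apply: Beta_antitone.
  - by rewrite addr_gt0// (lt_le_trans ltr01).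
  - by rewrite addr_gt0// (lt_le_trans ltr01).
  - have := yn; lra.
  - have := y1; lra.
have -> : forall b e : R, b / e * r = b * (r / e) by move=> *; rewrite mulrAC mulrA.
rewrite -mulrA ler_piMr ?(ltW (Beta_gt0 _ _ _ n1 n1))//.
rewrite mulrAC ler_pdivrMr// mul1r.
apply: (@le_trans _ _ (r * (2 / (r * p) + 2 / (r * (1 - p))))).
  by rewrite ler_pM2l//; exact: Beta_le.
have -> // : r * (2 / (r * p) + 2 / (r * (1 - p))) = 2 / p + 2 / (1 - p).
by field; rewrite !gt_eqF.
Qed.

End BetaRatio.

(** * Products over the groups: bounds of order [r ^ k] for the likelihood *)

Section LikelihoodBounds.
Context (R : realType) (k m : nat) (n y : 'I_k -> nat) (x : 'I_k -> m.-tuple R).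
Hypothesis interior : forall j, (1 <= y j <= n j - 1)%N.

Lemma pE_itv01 (b : m.-tuple R) j : 0 < pE x b j < 1.
Proof.
have e0 := expR_gt0 (linpred x b j).
have e1 : 0 < 1 + expR (linpred x b j) by rewrite addr_gt0.
by rewrite /pE divr_gt0//= ltr_pdivrMr// mul1r ltrDr.
Qed.

Lemma likelihoodE r (b : m.-tuple R) : likelihood n y x r b =
  \prod_(j < k) ('C(n j, y j)%:R * beta_ratio R (n j) (y j) (pE x b j) r).
Proof. by []. Qed.

Lemma likelihood_ge0 r (b : m.-tuple R) : 0 < r -> 0 <= likelihood n y x r b.
Proof.
move=> r0; rewrite likelihoodE; apply: prodr_ge0 => j _.
by rewrite mulr_ge0// beta_ratio_ge0// pE_itv01.
Qed.

Lemma likelihood_le : exists2 C : R, 0 <= C &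
  forall r (b : m.-tuple R), 0 < r -> likelihood n y x r b <= C * Num.min 1 r ^+ k.
Proof.
exists (\prod_(j < k) ('C(n j, y j)%:R * 16)).
  by apply: prodr_ge0 => j _; rewrite mulr_ge0.
move=> r b r0; rewrite likelihoodE.
have -> : Num.min 1 r ^+ k = \prod_(j < k) Num.min 1 r by rewrite prodr_const card_ord.
rewrite -big_split/=; apply: ler_prod => j _.
rewrite mulr_ge0 ?beta_ratio_ge0 ?pE_itv01//= -mulrA ler_wpM2l//.
by rewrite beta_ratio_le ?pE_itv01.
Qed.

Lemma likelihood_ge (b : m.-tuple R) : exists2 d : R, 0 < d &
  forall r, 0 < r <= 1 -> d * r ^+ k <= likelihood n y x r b.
Proof.
have /choice[d dP] : forall j, exists d : R, 0 < d /\
    forall r, 0 < r <= 1 -> d * r <= beta_ratio R (n j) (y j) (pE x b j) r.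
  by move=> j; have [d d0 dP] := beta_ratio_ge R _ _ _ (interior j) (pE_itv01 b j); exists d.
have C0 j : 0 < 'C(n j, y j)%:R :> R.
  rewrite ltr0n bin_gt0; have /andP[_ h] := interior j.
  by rewrite (leq_trans h)// leq_subr.
exists (\prod_(j < k) ('C(n j, y j)%:R * d j)).
  by apply: prodr_gt0 => j _; rewrite mulr_gt0//; have [] := dP j.
move=> r r01; rewrite likelihoodE.
have -> : r ^+ k = \prod_(j < k) r by rewrite prodr_const card_ord.
rewrite -big_split/=; apply: ler_prod => j _; have [d0 dr] := dP j.
rewrite -mulrA ler_wpM2l ?(ltW (C0 j)) ?dr// andbT mulr_ge0 ?(ltW (C0 j))//.
by rewrite mulr_ge0 ?(ltW d0)//; case/andP: r01 => /ltW.
Qed.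

End LikelihoodBounds.

(** * Integration against the hyper-priors, on either side of the threshold *)

Section Propriety.
Context (R : realType) (k m : nat) (n y : 'I_k -> nat) (x : 'I_k -> m.-tuple R).
Hypothesis interior : forall j, (1 <= y j <= n j - 1)%N.
Context (u c : R) (f : R -> R) (g : m.-tuple (measurableTypeR R) -> R).
Hypothesis hu : 0 < u.
Hypothesis hc : 0 < c.
Hypothesis hf : forall r : R, 0 < r -> f r = c * (1 / r `^ (u + 1)).
Hypothesis hg : is_pdf g.
Notation mu := (@lebesgue_measure R).

Let inner b := (\int[mu]_(r in `]0%R, +oo[)
  (f r * g b * likelihood n y x r b)%:E)%E.

Let f_ge0 r : 0 < r -> 0 <= f r.
Proof. by move=> r0; rewrite hf// mulr_ge0 ?(ltW hc)// divr_ge0// powR_ge0. Qed.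

Let posterior_ge0 r b : 0 < r -> 0 <= f r * g b * likelihood n y x r b.
Proof.
have [_ g0 _] := hg.
by move=> r0; rewrite mulr_ge0 ?likelihood_ge0// mulr_ge0 ?f_ge0.
Qed.

Let inner_ge0 b : (0 <= inner b)%E.
Proof.
apply: integral_ge0 => r /=; rewrite in_itv/= andbT lee_fin; exact: posterior_ge0.
Qed.

(** Both directions compare the inner integral pointwise in [b] with a multiple of [g b]; this
    evaluates the outer integral of that multiple. *)
Let int_scaled_pdf K : 0 <= K ->
  (\int[lebesgue_tuple R m]_b (K * g b)%:E = K%:E)%E.
Proof.
move=> K0; have [mg g0 g1] := hg.
under eq_integral do rewrite EFinM.
rewrite ge0_integralZl_EFin//; first by rewrite g1 mule1.
- by move=> b _; rewrite lee_fin.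
- exact/measurable_EFinP.
Qed.

Lemma posterior_proper_of_lt : u < k%:R -> posterior_proper f g (likelihood n y x).
Proof.
move=> uk; have [_ g0 _] := hg.
have [C C0 LC] := likelihood_le R k m n y x interior.
pose s := Num.min (k%:R - u) u.
have s0 : 0 < s by rewrite lt_min subr_gt0 uk hu.
(* [c] comes from [f], [C] from the likelihood bound and [4 / s] from the bump, whose own integral
   contributes at most 1. *)
pose K := c * C * (4 / s).
have K0 : 0 <= K by rewrite !mulr_ge0 ?invr_ge0 ?(ltW hc) ?(ltW s0).
apply: (@le_lt_trans _ _ K%:E); last exact: ltry.
rewrite -(int_scaled_pdf _ K0).
apply: ge0_le_integral_nomeas => b _; first exact: inner_ge0.
have Kg0 : 0 <= K * g b by rewrite mulr_ge0.
apply: le_trans (integral_powR_bump_le _ _ _ Kg0 s0).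
apply: ge0_le_integral_nomeas => r /=; rewrite in_itv/= andbT lee_fin => r0.
  exact: posterior_ge0.
have h1 := LC r b r0.
have h2 := powR_min_le_bump _ _ k _ hu uk r0 s erefl.
rewrite hf//.
apply: (@le_trans _ _ (c * C * g b * (1 / r `^ (u + 1) * Num.min 1 r ^+ k))).
  have -> : c * C * g b * (1 / r `^ (u + 1) * Num.min 1 r ^+ k) =
      c * (1 / r `^ (u + 1)) * g b * (C * Num.min 1 r ^+ k) by ring.
  by rewrite ler_wpM2l// mulr_ge0// -hf// f_ge0.
have -> : K * g b * (s * r `^ (s - 1) / (1 + r `^ s) ^+ 2) =
   c * C * g b * (4 / s * (s * r `^ (s - 1) / (1 + r `^ s) ^+ 2)).
  by rewrite /K -!mulrA; congr (_ * (_ * _)); rewrite mulrCA mulrC !mulrA; ring.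
by rewrite ler_wpM2l// !mulr_ge0 ?(ltW hc).
Qed.

Let inner_pinfty b : k%:R <= u -> 0 < g b -> inner b = +oo%E.
Proof.
move=> ku gb0; have [d d0 dL] := likelihood_ge R k m n y x interior b.
apply: (@integral_inv_pinfty R (c * g b * d)); first by rewrite !mulr_gt0.
  by move=> r; exact: posterior_ge0.
move=> r /[dup] r01 /andP[r0 r1]; rewrite hf//.
have h1 := dL r r01.
(* Here [k - u - 1 <= - 1] and [r <= 1], so the integrand is no smaller than the non-integrable
   [1 / r], up to a constant. *)
have h2 : r^-1 <= 1 / r `^ (u + 1) * r ^+ k.
  rewrite mulrAC mul1r ler_pdivlMr ?powR_gt0// mulrC -ler_pdivlMr ?invr_gt0// invrK.
  rewrite -exprSr -powR_mulrn ?(ltW r0)// ger_powR ?r0//.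
  by rewrite -natr1 lerD2r.
apply: (@le_trans _ _ (c * g b * d * (1 / r `^ (u + 1) * r ^+ k))).
  by rewrite ler_wpM2l// !mulr_ge0 ?ltW.
have -> : c * g b * d * (1 / r `^ (u + 1) * r ^+ k) =
   c * (1 / r `^ (u + 1)) * g b * (d * r ^+ k) by ring.
by rewrite ler_wpM2l// mulr_ge0 ?(ltW gb0)// -hf// f_ge0.
Qed.

(** For every [N > 0] the inner integral is at least [N * g b]: it is infinite where [g b > 0], and
    elsewhere the bound is 0. Integrating gives at least [N], so the set where [g] is positive never
    has to be measured. *)
Lemma posterior_improper_of_ge : k%:R <= u ->
  ~ posterior_proper f g (likelihood n y x).
Proof.
move=> ku; have [_ g0 _] := hg; rewrite /posterior_proper.
suff -> : (\int[lebesgue_tuple R m]_b inner b = +oo)%E by rewrite ltxx.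
apply/eqyP => N N0; rewrite -(int_scaled_pdf _ (ltW N0)).
apply: ge0_le_integral_nomeas => b _; first by rewrite lee_fin mulr_ge0// ltW.
have := g0 b; rewrite le_eqVlt => /predU1P[<-|gb0].
  by rewrite mulr0.
by rewrite inner_pinfty// leey.
Qed.

End Propriety.

(** The threshold for real [u] is [u < k]: with [u = 1/2] and [k = 1] the posterior is proper
    although [u + 1 > k]. The form [u + 1 <= k] is therefore asserted for integer [u], where the two
    inequalities agree. *)
Theorem theorem3p2 (R : realType) (k m : nat) (hm : (1 <= m)%N) (hkm : (m <= k)%N)
    (n y : 'I_k -> nat) (x : 'I_k -> m.-tuple R)
    (hn : forall j, (1 <= n j)%N)
    (interior : forall j, (1 <= y j <= n j - 1)%N)
    (u : R) (hu : 0 < u)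
    (f : R -> R) (c : R) (hc : 0 < c)
    (hf : forall r : R, 0 < r -> f r = c * (1 / r `^ (u + 1)))
    (g : m.-tuple (measurableTypeR R) -> R) (hg : is_pdf g) :
  (posterior_proper f g (likelihood n y x) <-> u < k%:R) /\
  (u \is a Num.int ->
     (posterior_proper f g (likelihood n y x) <-> u + 1 <= k%:R)).
Proof.
have key : posterior_proper f g (likelihood n y x) <-> u < k%:R.
  split=> [proper|uk].
    rewrite ltNge; apply/negP => ku.
    exact: (posterior_improper_of_ge _ _ _ n y x interior u c f g hc hf hg ku proper).
  exact: (posterior_proper_of_lt _ _ _ n y x interior u c f g hu hc hf hg uk).
split=> // /intrP[z uE]; rewrite key uE.
by rewrite -[1](mulr1z) -intrD -[k%:R]mulrz_nat ltr_int ler_int lezD1.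
Qed.
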